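(* Suppose that $\Xi=\mathbb{R}^{m_1}\times\mathbb{R}^{m_2}$ and $p=\infty$. If $x\in\mathcal X$ satisfies $T(x)\in\mathbb{R}_+^{\ell\times m_2}$ or $T(x)\in\mathbb{R}_-^{\ell\times m_2}$ (all entries nonnegative, or all entries nonpositive), then $$\mathcal Z(x)=\frac1N\sum_{j\in[N]}\min_{y\in\mathbb{R}^{n_2}}\left\{(Q\zeta_q^j+q)^\top y+\theta\|Q^\top y\|_1:\ T(x)\zeta_T^j+Wy-\theta|T(x)|e\ge h(x)\right\}.$$ Here $|T(x)|$ is the entrywise absolute value and $e\in\mathbb{R}^{m_2}$ is the all-one vector.
   Context: Setting. $[k]=\{1,\dots,k\}$. Let $n_1,n_2,m_1,m_2,\ell,N$ be positive integers, $\mathcal X\subseteq\mathbb{R}^{n_1}$, $c\in\mathbb{R}^{n_1}$, $W\in\mathbb{R}^{\ell\times n_2}$, $Q\in\mathbb{R}^{n_2\times m_1}$, $q\in\mathbb{R}^{n_2}$ fixed, and let $h:\mathbb{R}^{n_1}\to\mathbb{R}^{\ell}$ and $T:\mathbb{R}^{n_1}\to\mathbb{R}^{\ell\times m_2}$ be affine. The support is $\Xi=\Xi_q\times\Xi_T$ with $\Xi_q\subseteq\mathbb{R}^{m_1}$, $\Xi_T\subseteq\mathbb{R}^{m_2}$. For $\xi=(\xi_q,\xi_T)\in\Xi$ the recourse function is $$Z(x,\xi)=\min_{y\in\mathbb{R}^{n_2}}\{(Q\xi_q+q)^\top y:\ T(x)\xi_T+Wy\ge h(x)\}.$$ Minima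 are read as infima, equal to $+\infty$ if infeasible. Ambiguity set. Given $p\in[1,\infty]$, $\theta\ge0$ and points $\zeta^j=(\zeta_q^j,\zeta_T^j)\in\Xi$, $j\in[N]$, let $\mathbb{P}_{\tilde\zeta}$ be the empirical distribution putting mass $1/N$ on each $\zeta^j$. Let $W^\infty(\mathbb{P}_1,\mathbb{P}_2)$ be the infimum, over all joint distributions $\mathbb{Q}$ of $(\tilde\xi_1,\tilde\xi_2)$ with marginals $\mathbb{P}_1,\mathbb{P}_2$, of the $\mathbb{Q}$-essential supremum of $\|\tilde\xi_1-\tilde\xi_2\|_p$, where $\|\cdot\|_p$ is the $\ell_p$ norm on $\mathbb{R}^{m_1+m_2}$. Let $\mathcal P=\{\mathbb{P}:\mathbb{P}(\tilde\xi\in\Xi)=1,\ W^\infty(\mathbb{P},\mathbb{P}_{\tilde\zeta})\le\theta\}$ and $\mathcal Z(x)=\sup_{\mathbb{P}\in\mathcal P}\mathbb{E}_{\mathbb{P}}[Z(x,\tilde\xi)]$. Standing assumption (sufficiently expensive recourse). For all $x\in\mathcal X$ and $\xi\in\Xi$ the dual of the recourse problem is feasible, i.e. there is $\pi\in\mathbb{R}_+^\ell$ with $W^\top\pi=Q\xi_q+q$. *)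

(* Defs.v *)
From HB Require Import structures.
From mathcomp Require Import all_boot all_order all_algebra.
From mathcomp Require Import all_classical all_reals all_analysis.
From mathcomp Require Import ess_sup_inf.

Set Implicit Arguments.
Unset Strict Implicit.
Unset Printing Implicit Defensive.

Import Order.TTheory GRing.Theory Num.Theory.
Import numFieldNormedType.Exports.

Local Open Scope classical_set_scope.
Local Open Scope ring_scope.

Definition affine (R : realType) (U V : lmodType R) (f : U -> V) : Prop :=
  exists (L : {linear U -> V}) (b : V), forall x, f x = L x + b.

Definition mxle (R : realType) m n (A B : 'M[R]_(m, n)) : Prop :=
  forall i j, A i j <= B i j.

Definition dotv (R : realType) n (u v : 'cV[R]_n) : R := (u^T *m v) 0 0.

Definition absmx (R : realType) m n (A : 'M[R]_(m, n)) : 'M[R]_(m, n) :=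
  map_mx Num.norm A.

(* The l_p norm for p in [1, +oo]; the value at p = -oo is a placeholder. *)
Definition lpnorm (R : realType) n (p : \bar R) (v : 'cV[R]_n) : R :=
  match p with
  | EFin r => (\sum_i `|v i 0| `^ r) `^ r^-1
  | +oo%E => \big[Num.max/0]_i `|v i 0|
  | -oo%E => 0
  end.

(* Random vectors xi = (xi_q, xi_T), with the Borel sigma-algebra. *)
Definition xi_space (R : realType) (m1 m2 : nat) :=
  g_sigma_algebraType (@open ('cV[R]_m1 * 'cV[R]_m2)%type).

Definition xi_dist (R : realType) m1 m2 (p : \bar R)
    (xi zeta : xi_space R m1 m2) : R :=
  lpnorm p (col_mx (xi.1 - zeta.1) (xi.2 - zeta.2)).

(* The infimum of an empty feasible set is +oo. *)
Definition recourse (R : realType) n1 n2 m1 m2 l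
    (Q : 'M[R]_(n2, m1)) (q : 'cV[R]_n2) (W : 'M[R]_(l, n2))
    (h : 'cV[R]_n1 -> 'cV[R]_l) (T : 'cV[R]_n1 -> 'M[R]_(l, m2))
    (x : 'cV[R]_n1) (xi : xi_space R m1 m2) : \bar R :=
  ereal_inf [set (dotv (Q *m xi.1 + q) y)%:E
            | y in [set y : 'cV[R]_n2 | mxle (h x) (T x *m xi.2 + W *m y)]].

Definition expensive_recourse (R : realType) n1 n2 m1 m2 l
    (X : set 'cV[R]_n1) (Xi : set (xi_space R m1 m2))
    (Q : 'M[R]_(n2, m1)) (q : 'cV[R]_n2) (W : 'M[R]_(l, n2)) : Prop :=
  forall x, X x -> forall xi, Xi xi ->
    exists pi : 'cV[R]_l, mxle 0 pi /\ W^T *m pi = Q *m xi.1 + q.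

Definition empirical (R : realType) d (S : measurableType d) (N : nat)
    (zeta : 'I_N -> S) (A : set S) : \bar R :=
  ((N%:R^-1)%:E * \sum_(j < N) \d_(zeta j) A)%E.

Definition coupling (R : realType) d (S : measurableType d)
    (P1 P2 : set S -> \bar R) (J : probability (S * S)%type R) : Prop :=
  forall A, measurable A -> J (fst @^-1` A) = P1 A /\ J (snd @^-1` A) = P2 A.

Definition Winfty (R : realType) m1 m2 (p : \bar R)
    (P1 P2 : set (xi_space R m1 m2) -> \bar R) : \bar R :=
  ereal_inf [set ess_sup J (fun z => (xi_dist p z.1 z.2)%:E)
            | J in coupling P1 P2].

Definition ambiguity (R : realType) m1 m2 N (p : \bar R) (theta : R)
    (Xi : set (xi_space R m1 m2)) (zeta : 'I_N -> xi_space R m1 m2)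
    : set (probability (xi_space R m1 m2) R) :=
  [set P : probability (xi_space R m1 m2) R |
    P Xi = 1%E /\ (Winfty p P (empirical R zeta) <= theta%:E)%E].

(* The expectation is an extended-real integral, since the recourse value may
   be +oo. *)
Definition worst_case (R : realType) n1 n2 m1 m2 l N
    (Q : 'M[R]_(n2, m1)) (q : 'cV[R]_n2) (W : 'M[R]_(l, n2))
    (h : 'cV[R]_n1 -> 'cV[R]_l) (T : 'cV[R]_n1 -> 'M[R]_(l, m2))
    (p : \bar R) (theta : R)
    (Xi : set (xi_space R m1 m2)) (zeta : 'I_N -> xi_space R m1 m2)
    (x : 'cV[R]_n1) : \bar R :=
  ereal_sup [set (\int[P]_xi recourse Q q W h T x xi)%E
            | P in ambiguity p theta Xi zeta].

(* Main.v *)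
Require Import Defs.
From mathcomp Require Import all_boot all_order all_algebra.
From mathcomp Require Import all_classical all_reals all_analysis.
From mathcomp Require Import measurable_realfun ess_sup_inf lra.
Import Order.TTheory GRing.Theory Num.Theory.
Import numFieldNormedType.Exports.
Local Open Scope classical_set_scope.
Local Open Scope ring_scope.

Set Implicit Arguments.
Unset Strict Implicit.
Unset Printing Implicit Defensive.

(* Over a box around zeta_j the recourse value is bounded by the robust value
   V_j (the j-th minimum on the right-hand side), and V_j is attained: the sign
   condition on T(x) provides a single worst xi_T, and LP duality (Farkas)
   exchanges the minimum over y with the maximum over the box of xi_q.
   Hence the empirical measure on the worst points has expectation at least the
   average of the V_j.  Conversely, if P lies in the ambiguity set, then for
   every r > theta some coupling moves mass by at most r, so the expectation of
   g_r(xi) = min {V_j : |xi - zeta_j| <= r} is at most the average of the V_j;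
   g_r increases to g_theta >= Z(x, .) as r decreases to theta, and monotone
   convergence concludes.  This limit is taken on g_r because the robust value
   itself may jump to +oo when theta is enlarged. *)

(** * Farkas' lemma and linear programming duality *)

Section LinearInequalities.
Context {R : realType}.

Lemma mxle0P m n (A : 'M[R]_(m, n)) : mxle 0 A <-> forall i j, 0 <= A i j.
Proof. by split=> + i j => /(_ i j); rewrite mxE. Qed.

Lemma mxle_mul m n k (A : 'M[R]_(m, n)) (B C : 'M[R]_(n, k)) :
  mxle 0 A -> mxle B C -> mxle (A *m B) (A *m C).
Proof.
move=> A0 BC i j; rewrite !mxE; apply: ler_sum => k' _.
by apply: ler_wpM2l => //; have := A0 i k'; rewrite mxE.
Qed.

Lemma dotvE n (u v : 'cV[R]_n) : dotv u v = \sum_i u i 0 * v i 0.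
Proof. by rewrite /dotv mxE; apply: eq_bigr => i _; rewrite mxE. Qed.

Lemma dotvDr n (u v w : 'cV[R]_n) : dotv u (v + w) = dotv u v + dotv u w.
Proof. by rewrite /dotv mulmxDr mxE. Qed.

Lemma dotvBl n (u v w : 'cV[R]_n) : dotv (u - v) w = dotv u w - dotv v w.
Proof. by rewrite /dotv linearB mulmxBl !mxE. Qed.

Lemma dotvZr n a (u v : 'cV[R]_n) : dotv u (a *: v) = a * dotv u v.
Proof. by rewrite /dotv -scalemxAr mxE. Qed.

Lemma dotv0 n (u : 'cV[R]_n) : dotv u 0 = 0.
Proof. by rewrite /dotv mulmx0 mxE. Qed.

Lemma dotv_mulmxl m n (A : 'M[R]_(m, n)) (u : 'cV[R]_n) (v : 'cV[R]_m) :
  dotv (A *m u) v = dotv u (A^T *m v).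
Proof. by rewrite /dotv trmx_mul mulmxA. Qed.

Lemma dotv_col m n (u1 v1 : 'cV[R]_m) (u2 v2 : 'cV[R]_n) :
  dotv (col_mx u1 u2) (col_mx v1 v2) = dotv u1 v1 + dotv u2 v2.
Proof. by rewrite /dotv tr_col_mx mul_row_col mxE. Qed.

Lemma ler_dotv n (u v w : 'cV[R]_n) : mxle 0 u -> mxle v w -> dotv u v <= dotv u w.
Proof. by move=> u0 vw; apply: mxle_mul => // i j; have := u0 j i; rewrite !mxE. Qed.

Lemma mxle_col m n k (A B : 'M[R]_(m, k)) (C D : 'M[R]_(n, k)) :
  mxle (col_mx A C) (col_mx B D) <-> mxle A B /\ mxle C D.
Proof.
split=> [le|[AB CD] i j].
  by split=> i j; [have := le (lshift n i) j | have := le (rshift m i) j];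
    rewrite ?col_mxEu ?col_mxEd.
by case: (split_ordP i) => k' ->; rewrite ?col_mxEu ?col_mxEd.
Qed.

(* Bartl's induction: if some x0 satisfies all constraints but the first and
   violates the conclusion, the projection [1 + x0 alpha] along x0 onto the
   kernel of the first constraint alpha removes that constraint. *)
Lemma farkas m n (M : 'M[R]_(m, n)) (c : 'rV[R]_n) :
  (forall z : 'cV[R]_n, mxle 0 (M *m z) -> 0 <= (c *m z) 0 0) ->
  exists pi : 'rV[R]_m, mxle 0 pi /\ pi *m M = c.
Proof.
elim: m => [|m IH] in M c *.
  move=> H; exists 0; split; first by move=> i j.
  rewrite mul0mx; apply/rowP => j; rewrite mxE.
  have H0 (z : 'cV[R]_n) : 0 <= (c *m z) 0 0 by apply: H; case.
  have e (d : R) : (c *m (d *: delta_mx j 0 : 'cV[R]_n)) 0 0 = d * c 0 j.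
    by rewrite -scalemxAr -colE !mxE.
  by have := H0 (1 *: delta_mx j 0); have := H0 (-1 *: delta_mx j 0);
    rewrite !e; lra.
rewrite -[m.+1]/(1 + m)%N in M *.
have [al [N ->]] : exists (al : 'rV[R]_n) (N : 'M[R]_(m, n)), M = col_mx al N.
  by exists (usubmx M), (dsubmx M); rewrite vsubmxK.
move=> H.
have {}H (z : 'cV[R]_n) : 0 <= (al *m z) 0 0 -> mxle 0 (N *m z) -> 0 <= (c *m z) 0 0.
  move=> az Nz; apply: H; rewrite mul_col_mx; apply/mxle0P => i j.
  case: (split_ordP i) => k ->; rewrite ?col_mxEu ?col_mxEd ?ord1//.
  by move/mxle0P: Nz => /(_ k j); rewrite ord1.
have [[x0 [Nx0 cx0]]|noX] :=
  pselect (exists x0 : 'cV[R]_n, mxle 0 (N *m x0) /\ (c *m x0) 0 0 < 0); last first.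
  have [z Nz|pi [/mxle0P pi0 piN]] := IH N c.
    by rewrite leNgt; apply/negP => cz0; apply: noX; exists z.
  exists (row_mx 0 pi); rewrite mul_row_col mul0mx add0r; split=> //.
  apply/mxle0P => i j.
  by case: (split_ordP j) => k ->; rewrite ?row_mxEl ?row_mxEr ?mxE.
have alx0 : (al *m x0) 0 0 < 0.
  by rewrite ltNge; apply/negP => /H /(_ Nx0); rewrite leNgt cx0.
(* The positive factor -1 / ([al *m x0]) normalizes [al *m x0] to -1, which makes [P] below a
   projection onto the kernel of [al]. *)
wlog alx01 : x0 Nx0 cx0 alx0 / al *m x0 = - 1%:M.
  have a0 : 0 < - ((al *m x0) 0 0)^-1 by rewrite oppr_gt0 invr_lt0.
  move=> /(_ (- ((al *m x0) 0 0)^-1 *: x0)); apply.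
  - apply/mxle0P => i j; rewrite -scalemxAr mxE mulr_ge0 ?(ltW a0)//.
    by move/mxle0P: Nx0.
  - by rewrite -scalemxAr mxE pmulr_rlt0.
  - by rewrite -scalemxAr mxE pmulr_rlt0.
  - rewrite -scalemxAr; apply/rowP => i.
    by rewrite ord1 [LHS]mxE mulNr mulVf ?lt_eqF// !mxE eqxx.
pose P := 1%:M + x0 *m al.
have alP : al *m P = 0 by rewrite mulmxDr mulmx1 mulmxA alx01 mulNmx mul1mx subrr.
have [z Nz|pi [pi0 piE]] := IH (N *m P) (c *m P).
  by rewrite -mulmxA; apply: H; rewrite mulmxA ?alP ?mul0mx ?mxE.
(* Expanding [pi N P = c P] leaves this coefficient on [al]; it is nonnegative because
   [pi N x0 >= 0 > c x0]. *)
exists (row_mx (pi *m (N *m x0) - c *m x0) pi); split.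
  apply/mxle0P => i j; rewrite ord1.
  case: (split_ordP j) => k ->; rewrite ?row_mxEl ?row_mxEr; last by move/mxle0P: pi0.
  have piNx0 : 0 <= (pi *m (N *m x0)) 0 0.
    by have /(_ 0 0) := mxle_mul pi0 Nx0; rewrite mulmx0 [leLHS]mxE.
  by rewrite ord1 [leRHS]mxE [X in _ + X]mxE subr_ge0 (le_trans (ltW cx0)).
rewrite mul_row_col mulmxBl.
move: piE; rewrite /P !mulmxDr !mulmx1 !mulmxA => /(canRL (addrK _)) piE.
by rewrite [X in _ + X]piE addrC addrA subrK addrK.
Qed.

(* The homogenization in (z, s) of the system [d <= M z] is fed to
   Farkas' lemma; directions with s = 0 are recession directions. *)
Lemma affine_farkas m n (M : 'M[R]_(m, n)) (d : 'cV[R]_m) (c : 'cV[R]_n) (v : R) :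
  (exists z, mxle d (M *m z)) ->
  (forall z, mxle d (M *m z) -> v <= dotv c z) ->
  exists pi : 'cV[R]_m, [/\ mxle 0 pi, M^T *m pi = c & v <= dotv pi d].
Proof.
move=> [z0 z0P] H.
(* At (z, s) the rows read [M z - s d >= 0] and [s >= 0], and [cc] is [c z - v s]. The multiplier of
   the last row will be the slack of [v <= dotv pi d]. *)
pose MM : 'M[R]_(m + 1, n + 1) := block_mx M (- d) 0 1%:M.
pose cc : 'rV[R]_(n + 1) := row_mx c^T (- v%:M).
have [z|pi [/mxle0P pi0 piE]] := @farkas _ _ MM cc.
  have [y [s ->]] : exists (y : 'cV[R]_n) (s : 'cV[R]_1), z = col_mx y s.
    by exists (usubmx z), (dsubmx z); rewrite vsubmxK.
  rewrite mul_block_col mul_row_col mul0mx add0r mul1mx mulNmx mulNmx.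
  have [a ->] : exists a, s = a%:M by exists (s 0 0); rewrite -mx11_scalar.
  rewrite -[X in mxle X _]vsubmxK => /mxle_col [Mys /(_ 0 0) aP].
  have {aP}a0 : 0 <= a by move: aP; rewrite !mxE eqxx mulr1n.
  rewrite -scalar_mxM [leRHS]mxE [X in _ + X]mxE [X in - X]mxE eqxx mulr1n.
  rewrite -/(dotv c y) subr_ge0.
  have {}Mys : mxle (a *: d) (M *m y).
    by move=> i j; have := Mys i j; rewrite mul_mx_scalar !mxE subr_ge0.
  move: a0; rewrite le_eqVlt => /predU1P[a0|a0]; last first.
    have : v <= dotv c (a^-1 *: y).
      apply: H => i j; rewrite -scalemxAr mxE ler_pdivlMl//.
      by have := Mys i j; rewrite [X in X <= _]mxE.
    by rewrite dotvZr ler_pdivlMl// mulrC.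
  rewrite -a0 mulr0 leNgt; apply/negP => cy.
  (* With [c y < 0], this step from [z0] along the recession direction [y] reaches the value
     [v - 1], below the bound [v]. *)
  pose b := (v - 1 - dotv c z0) / dotv c y.
  have b0 : 0 <= b.
    by rewrite /b mulr_le0 ?invr_le0 ?(ltW cy)//; have := H _ z0P; lra.
  have : v <= dotv c (z0 + b *: y).
    apply: H => i j; rewrite mulmxDr -scalemxAr.
    have := Mys i j; rewrite -a0 scale0r => My.
    have : 0 <= b * (M *m y) i j by rewrite mulr_ge0//; move: My; rewrite mxE.
    have := z0P i j.
    rewrite [X in _ -> _ -> _ <= X]mxE [X in _ -> _ -> _ <= _ + X]mxE.
    lra.
  by rewrite dotvDr dotvZr /b mulfVK ?lt_eqF//; lra.
have [p [s piP]] : exists (p : 'rV[R]_m) (s : 'rV[R]_1), pi = row_mx p s.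
  by exists (lsubmx pi), (rsubmx pi); rewrite hsubmxK.
move: piE pi0; rewrite {}piP mul_row_block => /eq_row_mx [] pM pd pi0.
exists p^T; split.
- apply/mxle0P => i j; rewrite mxE; have := pi0 j (lshift 1 i).
  by rewrite row_mxEl.
- by rewrite -trmx_mul -[c]trmxK -pM mulmx0 addr0.
- move: pd => /(congr1 (fun A : 'M[R]_(1, 1) => A 0 0)).
  have := pi0 0 (rshift m 0); rewrite row_mxEr /dotv trmxK.
  rewrite mulmx1 mulmxN !mxE mulr1n; lra.
Qed.

End LinearInequalities.

(** * The robust recourse value and its attainment on a box *)

Section RobustRecourse.
Context {R : realType} {n1 n2 m1 m2 l : nat}.
Variables (W : 'M[R]_(l, n2)) (Q : 'M[R]_(n2, m1)) (q : 'cV[R]_n2).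
Variables (h : 'cV[R]_n1 -> 'cV[R]_l) (T : 'cV[R]_n1 -> 'M[R]_(l, m2)).
Variables (theta : R) (x : 'cV[R]_n1).
Hypothesis theta_ge0 : 0 <= theta.

Lemma addmxE m n (A B : 'M[R]_(m, n)) i j : (A + B) i j = A i j + B i j.
Proof. by rewrite mxE. Qed.

Lemma oppmxE m n (A : 'M[R]_(m, n)) i j : (- A) i j = - A i j.
Proof. by rewrite mxE. Qed.

Lemma scalemxE m n a (A : 'M[R]_(m, n)) i j : (a *: A) i j = a * A i j.
Proof. by rewrite mxE. Qed.

Lemma lpnorm1E n (v : 'cV[R]_n) : lpnorm 1%E v = \sum_i `|v i 0|.
Proof.
rewrite /lpnorm invr1 powRr1.
  by apply: eq_bigr => i _; rewrite powRr1.
by apply: sumr_ge0 => i _; rewrite powRr1.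
Qed.

Lemma lpnormy_le n (v : 'cV[R]_n) (r : R) : 0 <= r ->
  (lpnorm +oo%E v <= r) <-> (forall i, `|v i 0| <= r).
Proof.
move=> r0; split=> [/bigmax_leP[_ H] i|H]; first exact: H.
by apply/bigmax_leP.
Qed.

Lemma xi_disty_le (xi zeta : xi_space R m1 m2) (r : R) : 0 <= r ->
  (xi_dist +oo%E xi zeta <= r) <->
  (forall i, `|(xi.1 - zeta.1) i 0| <= r) /\
  (forall i, `|(xi.2 - zeta.2) i 0| <= r).
Proof.
move=> r0; rewrite /xi_dist lpnormy_le//; split=> [H|[H1 H2] i].
  by split=> i; [have := H (lshift m2 i) | have := H (rshift m1 i)];
    rewrite ?col_mxEu ?col_mxEd.
by case: (split_ordP i) => k ->; rewrite ?col_mxEu ?col_mxEd.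
Qed.

Lemma xi_disty0 (xi : xi_space R m1 m2) : xi_dist +oo%E xi xi <= 0.
Proof. by apply/xi_disty_le => //; split=> i; rewrite subrr mxE normr0. Qed.

Lemma normr_dotv n (u v : 'cV[R]_n) (r : R) : (forall i, `|u i 0| <= r) ->
  `|dotv u v| <= r * \sum_i `|v i 0|.
Proof.
move=> ur; rewrite dotvE mulr_sumr; apply: (le_trans (ler_norm_sum _ _ _)).
by apply: ler_sum => i _; rewrite normrM ler_wpM2r.
Qed.

Definition robust_recourse (zeta : xi_space R m1 m2) : \bar R :=
  ereal_inf
    [set (dotv (Q *m zeta.1 + q) y + theta * lpnorm 1%E (Q^T *m y))%:E
    | y in [set y : 'cV[R]_n2 |
        mxle (h x) (T x *m zeta.2 + W *m y
                    - theta *: (absmx (T x) *m const_mx 1))]].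

(** By Hoelder's inequality, passing from [zeta] to [xi] costs at most [theta |T(x)| e] in the
    constraints and [theta ||Q^T y||_1] in the objective, so each robust feasible [y] serves [xi] at
    no greater cost. *)
Lemma recourse_le_robust (xi zeta : xi_space R m1 m2) :
  xi_dist +oo%E xi zeta <= theta ->
  (recourse Q q W h T x xi <= robust_recourse zeta)%E.
Proof.
move=> /xi_disty_le [//|dq dT].
apply: le_ereal_inf_tmp => _ [y yP <-].
apply: ereal_inf_le; exists (dotv (Q *m xi.1 + q) y)%:E.
  exists y => //= i j; apply: (le_trans (yP i j)).
  have : - (theta * (absmx (T x) *m (const_mx 1 : 'cV_m2)) i 0) <=
      (T x *m (xi.2 - zeta.2)) i 0.
    have -> : (T x *m (xi.2 - zeta.2)) i 0 = dotv (xi.2 - zeta.2) (row i (T x))^T.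
      by rewrite dotvE mxE; apply: eq_bigr => k _; rewrite !mxE mulrC.
    have -> : (absmx (T x) *m (const_mx 1 : 'cV_m2)) i 0 =
        \sum_k `|(row i (T x))^T k 0|.
      by rewrite mxE; apply: eq_bigr => k _; rewrite !mxE mulr1.
    by rewrite lerNl; have /ler_normlP[] := normr_dotv (row i (T x))^T dT.
  rewrite mulmxBr !(addmxE, oppmxE, scalemxE) ord1; lra.
rewrite lee_fin -lerBlDl -dotvBl.
have -> : Q *m xi.1 + q - (Q *m zeta.1 + q) = Q *m (xi.1 - zeta.1).
  by rewrite mulmxBr opprD addrACA subrr addr0.
rewrite dotv_mulmxl lpnorm1E.
by have /ler_normlP[_] := normr_dotv (Q^T *m y) dq.
Qed.

(** Weak duality: a dual feasible [pi] bounds the value below by a real number. *)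
Lemma recourse_gtNy (xi : xi_space R m1 m2) :
  (exists pi : 'cV[R]_l, mxle 0 pi /\ W^T *m pi = Q *m xi.1 + q) ->
  (-oo < recourse Q q W h T x xi)%E.
Proof.
move=> [pi [pi0 piE]].
apply: (@lt_le_trans _ _ (dotv pi (h x - T x *m xi.2))%:E); first exact: ltNyr.
apply: le_ereal_inf_tmp => _ [y yP <-]; rewrite lee_fin -piE dotv_mulmxl trmxK.
by apply: ler_dotv => // i j; have := yP i j; rewrite !mxE lerBlDl.
Qed.

(* The sign condition makes one xi_T worst for all constraints at once; the
   worst xi_q is read off the multipliers u, w of the constraints
   [- t <= Q^T y <= t] linearizing the l_1 norm. *)
Lemma robust_attained (zeta : xi_space R m1 m2) :
  mxle 0 (T x) \/ mxle (T x) 0 ->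
  (exists pi : 'cV[R]_l, mxle 0 pi /\ W^T *m pi = Q *m zeta.1 + q) ->
  exists xi : xi_space R m1 m2, xi_dist +oo%E xi zeta <= theta /\
    (robust_recourse zeta <= recourse Q q W h T x xi)%E.
Proof.
move=> T_sign dual.
have [s s1 absT] : exists2 s : R, `|s| <= 1 & absmx (T x) = s *: T x.
  case: T_sign => T0; [exists 1|exists (-1)]; rewrite ?normrN1 ?normr1//;
    apply/matrixP => i j; have := T0 i j; rewrite !mxE => ?.
    by rewrite mul1r ger0_norm.
  by rewrite mulN1r ler0_norm.
(* Since [theta |T(x)| e = T(x) (s theta e)], the robust constraint is the nominal one at [xiT]. *)
pose xiT : 'cV[R]_m2 := zeta.2 - (s * theta) *: const_mx 1.
have xiTE y : T x *m zeta.2 + W *m y - theta *: (absmx (T x) *m const_mx 1) =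
    T x *m xiT + W *m y.
  by rewrite absT -scalemxAl scalerA mulmxBr -scalemxAr addrAC mulrC.
have xiTP i : `|(xiT - zeta.2) i 0| <= theta.
  rewrite addrAC subrr add0r !mxE mulr1 normrN normrM (ger0_norm theta_ge0).
  by rewrite ler_piMl.
have [[y0 y0P]|noY] :=
    pselect (exists y : 'cV[R]_n2, mxle (h x) (T x *m xiT + W *m y)); last first.
  (* Without a feasible [y] at [xiT] the recourse value is +oo, so [zeta.1] can stay in place. *)
  exists (zeta.1, xiT); split.
    by apply/xi_disty_le => //; split=> // i; rewrite subrr mxE normr0.
  rewrite [leRHS](_ : _ = +oo%E) ?leey//.
  rewrite -ereal_inf0; congr ereal_inf; apply/seteqP; split=> // _ [y yP <-].
  by apply: noY; exists y.
have : (-oo < robust_recourse zeta)%E.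
  apply: (lt_le_trans (recourse_gtNy dual)); apply: recourse_le_robust.
  exact: le_trans (xi_disty0 _) theta_ge0.
have robust_le y : mxle (h x) (T x *m xiT + W *m y) ->
    (robust_recourse zeta <= (dotv (Q *m zeta.1 + q) y
             + theta * lpnorm 1%E (Q^T *m y))%R%:E)%E.
  by move=> yP; apply: ereal_inf_lbound; exists y => //=; rewrite xiTE.
have := robust_le _ y0P.
case: (robust_recourse zeta) robust_le => [v||] // robust_le _ _.
pose b := h x - T x *m xiT.
have bE y : mxle b (W *m y) <-> mxle (h x) (T x *m xiT + W *m y).
  by split=> H i j; have := H i j; rewrite !mxE lerBlDl.
(* The linear program in (y, t) has rows [W y >= b], [t - Q^T y >= 0], [t + Q^T y >= 0], and [c]
   charges [theta] per unit of t. *)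
pose M := col_mx (row_mx W 0) (col_mx (row_mx (- Q^T) 1%:M) (row_mx Q^T 1%:M)).
have ME (y : 'cV[R]_n2) (t : 'cV[R]_m1) : M *m col_mx y t =
    col_mx (W *m y) (col_mx (t - Q^T *m y) (t + Q^T *m y)).
  rewrite !mul_col_mx !mul_row_col !mul1mx mul0mx addr0 mulNmx.
  by rewrite addrC [Q^T *m y + t]addrC.
pose c : 'cV[R]_(n2 + m1) := col_mx (Q *m zeta.1 + q) (const_mx theta).
have [||pi [pi0 piE piv]] := @affine_farkas _ _ _ M (col_mx b (col_mx 0 0)) c v.
- exists (col_mx y0 (\col_i `|(Q^T *m y0) i 0|)); rewrite ME.
  apply/mxle_col; split; first exact/bE.
  have dP i : - `|(Q^T *m y0) i 0| <= (Q^T *m y0) i 0 <= `|(Q^T *m y0) i 0|.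
    by rewrite -ler_norml.
  by apply/mxle_col; split; apply/mxle0P => i j; have := dP i;
    rewrite ord1 addmxE ?oppmxE [X in _ -> _ <= X + _]mxE; lra.
- move=> z.
  have [y [t ->]] : exists (y : 'cV[R]_n2) (t : 'cV[R]_m1), z = col_mx y t.
    by exists (usubmx z), (dsubmx z); rewrite vsubmxK.
  rewrite ME => /mxle_col [/bE /robust_le + /mxle_col [t1 t2]].
  rewrite lee_fin => /le_trans; apply; rewrite dotv_col lerD2l lpnorm1E dotvE.
  rewrite mulr_sumr; apply: ler_sum => i _; rewrite [X in X * t _ _]mxE.
  apply: ler_wpM2l => //; apply/ler_normlP.
  by have := t1 i 0; have := t2 i 0; rewrite !mxE; split; lra.
have [p [u [w piuw]]] : exists (p : 'cV[R]_l) (u w : 'cV[R]_m1),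
    pi = col_mx p (col_mx u w).
  by exists (usubmx pi), (usubmx (dsubmx pi)), (dsubmx (dsubmx pi));
    rewrite !vsubmxK.
move: pi0 piE piv; rewrite {}piuw dotv_col dotv_col !dotv0 !addr0.
rewrite -[X in mxle X _]vsubmxK => /mxle_col[p0].
rewrite -[X in mxle X _]vsubmxK => /mxle_col[u0 w0].
have {}p0 : mxle 0 p by apply/mxle0P => i j; have := p0 i j; rewrite !mxE.
have {}u0 i : 0 <= u i 0 by have := u0 i 0; rewrite !mxE.
have {}w0 i : 0 <= w i 0 by have := w0 i 0; rewrite !mxE.
have -> : M^T *m col_mx p (col_mx u w) = col_mx (W^T *m p - Q *m (u - w)) (u + w).
  rewrite !tr_col_mx !tr_row_mx !mul_row_col !mul_col_mx !trmx1 !mul1mx trmx0 mul0mx.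
  rewrite linearN /= !trmxK mulNmx !add_col_mx add0r.
  by rewrite mulmxBr opprB addrA addrAC addrA.
move=> /eq_col_mx[pE uw] pv.
(* As [u + w] is constantly [theta], the shift [u - w] stays in the box; [pE] says that [p] is dual
   feasible at the shifted point, so weak duality carries [v] there. *)
exists (zeta.1 + (u - w), xiT); split.
  apply/xi_disty_le => //; split=> // i /=.
  rewrite addrAC subrr add0r addmxE oppmxE.
  have : u i 0 + w i 0 = theta by rewrite -addmxE uw mxE.
  by have := u0 i; have := w0 i; move=> *; apply/ler_normlP; split; lra.
apply: le_ereal_inf_tmp => _ [y yP <-]; rewrite lee_fin.
rewrite /= mulmxDr addrAC -pE subrK dotv_mulmxl trmxK (le_trans pv)//.
by apply: ler_dotv => //; exact/bE.
Qed.

End RobustRecourse.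

(** * Sup-norm balls, integrals and empirical measures *)

Section XiSpace.
Context {R : realType}.

(** The ball is a finite intersection of coordinate slabs, whose complements are open and hence
    generators of the sigma-algebra. *)
Lemma measurable_xi_ball m1 m2 (zeta : xi_space R m1 m2) (r : R) : 0 <= r ->
  measurable [set xi : xi_space R m1 m2 | xi_dist +oo%E xi zeta <= r].
Proof.
move=> r0.
have mcoord (f : 'cV[R]_m1 * 'cV[R]_m2 -> R) a : continuous f ->
    measurable [set xi : xi_space R m1 m2 | `|f xi - a| <= r].
  move=> cf; rewrite -[X in measurable X]setCK; apply: measurableC.
  apply: sub_sigma_algebra.
  have -> : ~` [set xi : xi_space R m1 m2 | `|f xi - a| <= r] =
      (fun xi => `|f xi - a|) @^-1` [set t | r < t].
    by apply/seteqP; split=> xi /=; rewrite ltNge => /negP.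
  apply: open_comp; last exact: open_gt.
  by move=> xi _; apply: cvg_norm; apply: cvgB; [exact: cf|exact: cvg_cst].
have -> : [set xi : xi_space R m1 m2 | xi_dist +oo%E xi zeta <= r] =
    (\bigcap_(i in [set: 'I_m1])
      [set xi : xi_space R m1 m2 | `|xi.1 i 0 - zeta.1 i 0| <= r]) `&`
    (\bigcap_(i in [set: 'I_m2])
      [set xi : xi_space R m1 m2 | `|xi.2 i 0 - zeta.2 i 0| <= r]).
  apply/seteqP; split=> xi /=.
    by move=> /xi_disty_le [//|H1 H2]; split=> i _ /=; [have := H1 i|have := H2 i];
      rewrite addmxE oppmxE.
  move=> [H1 H2]; apply/xi_disty_le => //; split=> i; rewrite addmxE oppmxE.
    exact: H1.
  exact: H2.
apply: measurableI; apply: fin_bigcap_measurable => [|i _]; try exact: finite_finset.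
- apply: (mcoord (fun xi => xi.1 i 0)) => xi.
  apply: (@continuous_comp _ _ _ fst (fun M : 'cV[R]_m1 => M i 0)).
    exact: cvg_fst.
  exact: coord_continuous.
- apply: (mcoord (fun xi => xi.2 i 0)) => xi.
  apply: (@continuous_comp _ _ _ snd (fun M : 'cV[R]_m2 => M i 0)).
    exact: cvg_snd.
  exact: coord_continuous.
Qed.

Lemma xi_disty_triangle m1 m2 (a b c : xi_space R m1 m2) (r s : R) :
  0 <= r -> 0 <= s -> xi_dist +oo%E a b <= r -> xi_dist +oo%E b c <= s ->
  xi_dist +oo%E a c <= r + s.
Proof.
move=> r0 s0 /xi_disty_le[//|ab1 ab2] /xi_disty_le[//|bc1 bc2].
apply/xi_disty_le; first exact: addr_ge0.
by split=> i; [rewrite -(subrKA b.1)|rewrite -(subrKA b.2)];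
  rewrite addmxE (le_trans (ler_normD _ _))// lerD.
Qed.

Lemma xi_disty0_eq m1 m2 (a b : xi_space R m1 m2) : xi_dist +oo%E a b <= 0 -> a = b.
Proof.
case: a b => [a1 a2] [b1 b2] /xi_disty_le[//|/= ab1 ab2].
by congr pair; apply/colP => i; apply/eqP;
  rewrite -subr_eq0 -oppmxE -addmxE -normr_le0.
Qed.

(* The integral of a nonnegative function is a supremum over the simple
   functions below it, so monotonicity requires no measurability; this spares
   the proof that the recourse function is measurable. *)
Lemma le_integral_nonmeasurable d (S : measurableType d)
    (mu : {measure set S -> \bar R}) (f g : S -> \bar R) :
  (forall s, (f s <= g s)%E) -> (\int[mu]_s f s <= \int[mu]_s g s)%E.
Proof.
have ge0 (u v : S -> \bar R) : (forall s, (0 <= u s)%E) -> (forall s, (u s <= v s)%E) ->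
    (\int[mu]_s u s <= \int[mu]_s v s)%E.
  move=> u0 uv; rewrite !ge0_integralTE//; last first.
    by move=> s; exact: le_trans (uv s).
  by apply: le_ereal_sup => _ [k ku <-]; exists k => // s; exact: le_trans (uv s).
move=> fg; rewrite [leLHS]integralE [leRHS]integralE.
apply: leeB; apply: ge0 => s; rewrite ?funepos_ge0 ?funeneg_ge0//.
  by rewrite !funeposE le_max2.
by rewrite !funenegE le_max2// leeN2.
Qed.

Lemma empirical_probability d (S : measurableType d) N
    (zeta : 'I_N -> S) : (0 < N)%N ->
  exists mu : probability S R,
    (forall A, mu A = empirical R zeta A) /\
    (forall f : S -> \bar R, measurable_fun setT f -> (forall s, (0 <= f s)%E) ->
       \int[mu]_s f s = (N%:R^-1)%:E * \sum_(j < N) f (zeta j))%E.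
Proof.
move=> N0.
pose z k := if insub k is Some j then zeta j else zeta (Ordinal N0).
have zE (j : 'I_N) : z j = zeta j by rewrite /z valK.
have N1 : 0 <= (N%:R^-1 : R) by [].
pose m : {measure set S -> \bar R} := mscale (NngNum N1) (msum (fun k => \d_(z k)) N).
have mE A : m A = empirical R zeta A.
  rewrite /m/= /mscale/= /msum /empirical; congr (_ * _)%E.
  by apply: eq_bigr => j _; rewrite zE.
have mT : m setT = 1%E.
  rewrite mE /empirical; under eq_bigr do rewrite diracT.
  rewrite sumEFin -EFinM big_const_ord iter_addr_0 -[X in _ * X]/(N%:R).
  by rewrite mulVf// pnatr_eq0 -lt0n.
(* Normalization is the identity here: it only bundles m as a probability. *)
pose p : probability S R := mnormalize m (\d_(z 0)).
have pm A : p A = m A by rewrite /p/= /mnormalize mT onee_eq0/= invr1 mule1.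
exists p; split=> [A|f mf f0]; first by rewrite -mE; exact: pm.
rewrite (eq_measure_integral m) => [|A _ _]; last exact: pm.
rewrite ge0_integral_mscale// ge0_integral_measure_sum//; congr (_ * _)%E.
by apply: eq_bigr => j _; rewrite integral_dirac// diracT mul1e zE.
Qed.

(** * Lower envelopes over balls *)

Section MinBall.
Context {m1 m2 N : nat} (a : 'I_N -> xi_space R m1 m2).

(** This is [g_r] of the overview for general centres and values, +oo outside all balls. Radius 0
    compares the values of coinciding centres. *)
Definition min_ball (u : 'I_N -> \bar R) (r : R) (xi : xi_space R m1 m2) : \bar R :=
  \big[mine/+oo%E]_(j < N) (if xi_dist +oo%E xi (a j) <= r then u j else +oo%E).

Lemma measurable_min_ball u r : 0 <= r -> measurable_fun setT (min_ball u r).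
Proof.
move=> r0; rewrite /min_ball; elim: (index_enum _) => [|j s IH].
  by under eq_fun do rewrite big_nil; exact: measurable_cst.
under eq_fun do rewrite big_cons; apply: measurable_mine => //.
apply: measurable_fun_ifT => //; apply: (measurable_fun_bool true).
by rewrite setTI; exact: measurable_xi_ball.
Qed.

Lemma min_ball_ge u r xi (t : \bar R) :
  (forall j, xi_dist +oo%E xi (a j) <= r -> (t <= u j)%E) -> (t <= min_ball u r xi)%E.
Proof.
by move=> H; apply: le_bigmin => [|j _]; [|case: ifPn => [/H//|_]]; exact: leey.
Qed.

Lemma min_ball_le u r xi j :
  xi_dist +oo%E xi (a j) <= r -> (min_ball u r xi <= u j)%E.
Proof. by move=> H; apply: (bigmin_inf j) => //; rewrite H. Qed.

(** The sequence is eventually constant: a centre farther than [r] is also farther than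
    [r + n.+1%:R^-1] for large n, and there are finitely many centres. *)
Lemma min_ball_cvg u r xi : 0 <= r ->
  min_ball u (r + n.+1%:R^-1) xi @[n --> \oo] --> min_ball u r xi.
Proof.
move=> r0; apply: cvg_near_cst.
have : \forall n \near \oo, forall j,
    (xi_dist +oo%E xi (a j) <= r + n.+1%:R^-1) = (xi_dist +oo%E xi (a j) <= r).
  apply: filter_forall => j.
  have [le|gt] := leP (xi_dist +oo%E xi (a j)) r.
    by apply: nearW => n; rewrite ler_wpDr.
  have d0 : 0 < xi_dist +oo%E xi (a j) - r by rewrite subr_gt0.
  apply: filterS (near_infty_natSinv_lt (PosNum d0)) => n /=.
  by rewrite ltrBrDl => /lt_geF.
by apply: filterS => n H; apply: eq_bigr => j _; rewrite H.
Qed.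

Lemma min_ball_antimono u r s xi : r <= s -> (min_ball u s xi <= min_ball u r xi)%E.
Proof.
move=> rs; apply: min_ball_ge => j jr; apply: min_ball_le; exact: le_trans rs.
Qed.

End MinBall.

End XiSpace.

(** * Upper and lower bounds on the worst-case expectation *)

Section WorstCaseBounds.
Context {R : realType} {m1 m2 N : nat}.
Variables (theta : R) (zeta : 'I_N -> xi_space R m1 m2).
Hypotheses (theta_ge0 : 0 <= theta) (N_gt0 : (0 < N)%N).

(* Along a coupling of essential width at most r, [min_ball zeta u r] at the
   first point is below [min_ball zeta u 0] at the second, by the triangle
   inequality. *)
Lemma integral_min_ball_le (P : probability (xi_space R m1 m2) R)
    (u : 'I_N -> \bar R) (r : R) :
  (forall j, (0 <= u j)%E) -> theta < r ->
  (Winfty +oo%E P (empirical R zeta) <= theta%:E)%E ->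
  (\int[P]_xi min_ball zeta u r xi <= (N%:R^-1)%:E * \sum_(j < N) u j)%E.
Proof.
move=> u0 rt WP; have r0 : 0 <= r by rewrite (le_trans theta_ge0)// ltW.
(* The infimum over couplings is not assumed attained; the slack [theta < r] provides a coupling. *)
have [_ [J JP <-] Jr] : exists2 y, [set ess_sup J (fun z => (xi_dist +oo%E z.1 z.2)%:E)
    | J in coupling P (empirical R zeta)] y & (y < r%:E)%E.
  by apply: ereal_inf_lt; apply: (le_lt_trans WP); rewrite lte_fin.
have /ess_supP Jae := ltW Jr.
have G0 s xi : (0 <= min_ball zeta u s xi)%E by apply: min_ball_ge.
have [mu [muE intmu]] := @empirical_probability R _ _ _ zeta N_gt0.
have mG s : 0 <= s -> measurable_fun setT (min_ball zeta u s).
  exact: measurable_min_ball.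
have -> : (\int[P]_xi min_ball zeta u r xi = \int[J]_z min_ball zeta u r z.1)%E.
  have := ge0_integral_pushforward measurable_fst J measurableT (mG _ r0) (fun x _ => G0 r x).
  rewrite preimage_setT => <-; apply: eq_measure_integral => A mA _.
  exact: (esym (JP A mA).1).
apply: (@le_trans _ _ (\int[J]_z min_ball zeta u 0 z.2)%E).
  apply: ae_ge0_le_integral => //.
  - exact: measurableT_comp (mG _ r0) measurable_fst.
  - exact: measurableT_comp (mG _ (lexx 0)) measurable_snd.
  apply: filterS Jae => z; rewrite lee_fin => zr _ /=.
  apply: min_ball_ge => j z2; apply: min_ball_le.
  by rewrite -[r]addr0; exact: xi_disty_triangle zr z2.
have -> : (\int[J]_z min_ball zeta u 0 z.2 = \int[mu]_xi min_ball zeta u 0 xi)%E.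
  have := ge0_integral_pushforward measurable_snd J measurableT (mG _ (lexx 0))
    (fun x _ => G0 0 x).
  rewrite preimage_setT => <-; apply: eq_measure_integral => A mA _.
  exact: etrans (JP A mA).2 (esym (muE A)).
rewrite intmu//; last exact: mG.
apply: lee_wpmul2l; first by rewrite lee_fin.
(* Only an inequality: coinciding points [zeta j] share the least of their values. *)
by apply: lee_sum => j _; apply: min_ball_le; exact: xi_disty0.
Qed.

Lemma integral_ambiguity_le (P : probability (xi_space R m1 m2) R)
    (f : xi_space R m1 m2 -> \bar R) (V : 'I_N -> \bar R) :
  (forall j, (-oo < V j)%E) ->
  (forall j xi, xi_dist +oo%E xi (zeta j) <= theta -> (f xi <= V j)%E) ->
  (Winfty +oo%E P (empirical R zeta) <= theta%:E)%E ->
  (\int[P]_xi f xi <= (N%:R^-1)%:E * \sum_(j < N) V j)%E.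
Proof.
move=> VNy fV WP.
have N1 : 0 < N%:R^-1 :> R by rewrite invr_gt0 ltr0n.
have [[j Vj]|noy] := pselect (exists j, V j = +oo%E).
  have -> : (\sum_(j < N) V j)%R = +oo%E.
    apply/eqP; rewrite esum_eqy; last by move=> i _; rewrite gt_eqF.
    by apply/existsP; exists j; rewrite Vj.
  by rewrite gt0_muley ?lte_fin// leey.
have {noy}VE j : V j = (fine (V j))%:E.
  rewrite fineK// fin_numE gt_eqF//=; apply/eqP => Vj; apply: noy; by exists j.
pose v j := fine (V j).
(* A lower bound of all [v j]: subtracting it gives the nonnegativity that monotone convergence
   requires, and its integral under a probability is [c] again. *)
pose c : R := - \sum_j `|v j|.
pose u j : \bar R := (v j - c)%:E.
have u0 j : (0 <= u j)%E.
  rewrite lee_fin subr_ge0 /c lerNl (bigD1 j)//= ler_wpDr ?sumr_ge0//.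
  by rewrite -normrN ler_norm.
pose G r := min_ball zeta u r.
have G0 r xi : (0 <= G r xi)%E by apply: min_ball_ge.
have rn0 n : 0 <= theta + n.+1%:R^-1 :> R by rewrite addr_ge0.
have intG : (\int[P]_xi G theta xi <= (N%:R^-1)%:E * \sum_(j < N) u j)%E.
  have mono : {homo (fun n => G (theta + n.+1%:R^-1)) : n m / (n <= m)%N >->
      forall xi, (n xi <= m xi)%E}.
    move=> n m nm xi; apply: min_ball_antimono.
    by rewrite lerD2l lef_pV2 ?posrE// ler_nat ltnS.
  have cv := @cvg_monotone_convergence _ _ _ P setT measurableT
    (fun n => G (theta + n.+1%:R^-1)) (fun n => measurable_min_ball zeta u (rn0 n))
    (fun n x _ => G0 _ x) (fun x _ n m nm => mono n m nm x).
  rewrite [leLHS](_ : _ = (\int[P]_x limn (fun n => G (theta + n.+1%:R^-1)%R x))%E); last first.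
    by apply: eq_integral => x _; apply/esym/cvg_lim => //; exact: min_ball_cvg.
  rewrite -(cvg_lim _ cv)//; apply: lime_le; first by apply/cvg_ex; eexists; exact: cv.
  apply: nearW => n; apply: integral_min_ball_le => //.
  by rewrite ltrDl invr_gt0.
have sumu : ((N%:R^-1)%:E * \sum_(j < N) u j + c%:E = (N%:R^-1)%:E * \sum_(j < N) V j)%E.
  under [in RHS]eq_bigr do rewrite VE.
  rewrite !sumEFin -!EFinM -EFinD sumrB big_const_ord iter_addr_0; congr EFin.
  by rewrite mulrBr -(mulr_natr c) mulrCA mulVf ?mulr1 ?subrK// pnatr_eq0 -lt0n.
rewrite -sumu.
apply: (@le_trans _ _ (\int[P]_xi (G theta xi + c%:E))%E).
  apply: le_integral_nonmeasurable => xi; rewrite -leeBlDr//.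
  by apply: min_ball_ge => j /fV; rewrite VE => fj; rewrite /u EFinB leeB.
have mG : measurable_fun setT (G theta) by exact: measurable_min_ball.
rewrite integralD//.
- rewrite [X in (_ + X)%E](_ : _ = c%:E) ?leeD2r// [LHS]integral_cst//.
  by rewrite [X in (_ * X)%E](_ : _ = 1%E) ?mule1//; exact: probability_setT.
- apply/integrableP; split=> //.
  under eq_integral do rewrite gee0_abs//.
  by apply: (le_lt_trans intG); rewrite sumEFin -EFinM ltry.
- exact: finite_measure_integrable_cst.
Qed.

(** The witness is the uniform law on the points [xi j]; pairing [xi j] with [zeta j] couples it to
    the empirical law within distance [theta]. *)
Lemma ambiguity_ge (f : xi_space R m1 m2 -> \bar R) (V : 'I_N -> \bar R)
    (xi : 'I_N -> xi_space R m1 m2) :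
  (forall j, (-oo < V j)%E) ->
  (forall j, xi_dist +oo%E (xi j) (zeta j) <= theta) ->
  (forall j, (V j <= f (xi j))%E) ->
  exists P : probability (xi_space R m1 m2) R,
    ambiguity +oo%E theta setT zeta P /\
    ((N%:R^-1)%:E * \sum_(j < N) V j <= \int[P]_xi f xi)%E.
Proof.
move=> VNy xizeta Vf.
have [P [PE intP]] := @empirical_probability R _ _ _ xi N_gt0.
have [J [JE _]] := @empirical_probability R _ _ _ (fun j => (xi j, zeta j)) N_gt0.
exists P; split.
  split; first exact: probability_setT.
  apply: (@le_trans _ _ (ess_sup J (fun z => (xi_dist +oo%E z.1 z.2)%:E))).
    apply: ereal_inf_lbound; exists J => // A mA.
    by rewrite PE !JE /empirical; split; congr (_ * _)%E; apply: eq_bigr => j _;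
      rewrite !diracE; congr (_ %:R%:E); apply/idP/idP; rewrite !inE.
  apply/ess_supP.
  have m1t (a : xi_space R m1 m2) : measurable [set a].
    rewrite [X in measurable X](_ : _ = [set b | xi_dist +oo%E b a <= 0]).
      exact: measurable_xi_ball.
    by apply/seteqP; split=> b /= => [->|/xi_disty0_eq//]; exact: xi_disty0.
  (* [J] is carried by the finitely many pairs, so their complement is the null set. *)
  exists (~` \bigcup_(j in [set: 'I_N]) ([set xi j] `*` [set zeta j])); split.
  - apply: measurableC; apply: fin_bigcup_measurable => [|j _]; first exact: finite_finset.
    exact: measurableX.
  - apply: etrans (JE _) _; rewrite /empirical big1 ?mule0// => j _; rewrite diracE memNset//.
    by apply; exists j.
  - move=> [a b] far [j _ [/= aE bE]]; apply: far.
    by rewrite /= aE bE lee_fin; exact: xizeta.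
(* The maximum of the [V j] over the atoms equal to [s], and -oo elsewhere: a measurable minorant of
   [f]. *)
pose g s := (- min_ball xi (fun j => - V j)%E 0 s)%E.
have gf s : (g s <= f s)%E.
  by rewrite /g leeNl; apply: min_ball_ge => j /xi_disty0_eq ->; rewrite leeN2.
have Vg j : (V j <= g (xi j))%E.
  by rewrite leeNr; apply: min_ball_le; exact: xi_disty0.
have mg : measurable_fun setT g.
  by apply: measurableT_comp => //; exact: measurable_min_ball.
apply: (@le_trans _ _ (\int[P]_s g s)%E); last exact: le_integral_nonmeasurable.
rewrite integralE !intP//; last 2 first.
- exact: measurable_funeneg.
- exact: measurable_funepos.
(* Finite negative parts at the atoms keep the difference of the two sums from being +oo - +oo. *)
have negfin j : g^\-%E (xi j) \is a fin_num.
  rewrite ge0_fin_numE ?funeneg_ge0// funenegE gt_max ltry andbT.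
  by rewrite lteNl/= (lt_le_trans (VNy j)).
rewrite -muleBr//; last first.
  by rewrite fin_num_adde_defl// fin_numN; apply/sum_fin_numP => j _ _.
rewrite lee_wpmul2l ?lee_fin//.
rewrite -fin_num_sumeN// -big_split/=; apply: lee_sum => j _.
by apply: (le_trans (Vg j)); rewrite {1}(funeposneg g).
Qed.

End WorstCaseBounds.

Theorem theorem1 (R : realType) (n1 n2 m1 m2 l N : nat)
    (hn1 : (0 < n1)%N) (hn2 : (0 < n2)%N) (hm1 : (0 < m1)%N)
    (hm2 : (0 < m2)%N) (hl : (0 < l)%N) (hN : (0 < N)%N)
    (X : set 'cV[R]_n1)
    (W : 'M[R]_(l, n2)) (Q : 'M[R]_(n2, m1)) (q : 'cV[R]_n2)
    (h : 'cV[R]_n1 -> 'cV[R]_l) (T : 'cV[R]_n1 -> 'M[R]_(l, m2))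
    (h_affine : affine h) (T_affine : affine T)
    (Xi_q : set 'cV[R]_m1) (Xi_T : set 'cV[R]_m2)
    (p : \bar R) (p_ge1 : (1 <= p)%E) (theta : R) (theta_ge0 : 0 <= theta)
    (zeta : 'I_N -> xi_space R m1 m2)
    (zetaXi : forall j, (Xi_q `*` Xi_T) (zeta j))
    (recourseP : expensive_recourse X (Xi_q `*` Xi_T) Q q W)
    (Xi_qE : Xi_q = setT) (Xi_TE : Xi_T = setT) (pE : p = +oo%E)
    (x : 'cV[R]_n1) (Xx : X x)
    (T_sign : mxle 0 (T x) \/ mxle (T x) 0) :
  worst_case Q q W h T p theta (Xi_q `*` Xi_T) zeta x =
  ((N%:R^-1)%:E *
   \sum_(j < N)
     ereal_inf
       [set (dotv (Q *m (zeta j).1 + q) y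
             + theta * lpnorm 1%E (Q^T *m y))%R%:E
       | y in [set y : 'cV[R]_n2 |
           mxle (h x) (T x *m (zeta j).2 + W *m y
                       - theta *: (absmx (T x) *m const_mx 1))%R]])%E.
Proof.
have dual (xi : xi_space R m1 m2) : exists pi : 'cV[R]_l, mxle 0 pi /\ W^T *m pi = Q *m xi.1 + q.
  by apply: (recourseP x Xx xi); rewrite Xi_qE Xi_TE.
rewrite {recourseP zetaXi}Xi_qE Xi_TE setXTT pE.
rewrite [RHS](_ : _ = (N%:R^-1)%:E *
  \sum_(j < N) robust_recourse W Q q h T theta x (zeta j))%E//.
have robust_gtNy j : (-oo < robust_recourse W Q q h T theta x (zeta j))%E.
  apply: (lt_le_trans (recourse_gtNy h T x (dual (zeta j)))).
  by apply: recourse_le_robust => //; exact: le_trans (xi_disty0 _) _.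
apply/eqP; rewrite eq_le; apply/andP; split.
  apply: ge_ereal_sup => _ [P [_ WP] <-].
  by apply: integral_ambiguity_le WP => // j xi; exact: recourse_le_robust.
have /choice[xi xiP] j := robust_attained h theta_ge0 T_sign (dual (zeta j)).
have [j|j|P [PA intP]] := @ambiguity_ge _ _ _ _ theta zeta hN
  (recourse Q q W h T x) _ xi robust_gtNy.
- exact: (xiP j).1.
- exact: (xiP j).2.
by apply: le_trans intP _; apply: ereal_sup_ubound; exists P.
Qed.
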